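(* Let $\mathbf{r}: S^1\to\mathbb{R}^2$ be a $C^\infty$ immersion whose no-silhouette $\mathcal{NS}_{\mathbf{r}}$ is non-empty, and let $\theta_{\mathbf{r}}$ be its aperture angle. Then for any $\theta$ with $0<\theta<\theta_{\mathbf{r}}$, the topological closure $\overline{\mathcal{NS}_{\theta,\mathbf{r}}}$ is never a polygon (even if $\overline{\mathcal{NS}_{\mathbf{r}}}$ is a polygon).
   Context: Let $\mathbf{r}: S^1\to\mathbb{R}^2$ be a $C^\infty$ immersion. For $s\in S^1$, $d\mathbf{r}_s(T_s(S^1))$ is regarded as a one-dimensional linear subspace of $\mathbb{R}^2$ (identifying $T_{\mathbf{r}(s)}\mathbb{R}^2$ with $\mathbb{R}^2$), so that $\mathbf{r}(s)+d\mathbf{r}_s(T_s(S^1))$ is the affine tangent line at $\mathbf{r}(s)$. For a real number $\theta$, let $R_\theta:\mathbb{R}^2\to\mathbb{R}^2$ be the rotation $R_\theta(x,y)=(x\cos\theta-y\sin\theta,\ x\sin\theta+y\cos\theta)$ and define $$\mathcal{NS}_{\theta,\mathbf{r}}=\mathbb{R}^2-\bigcup_{s\in S^1}\left(\mathbf{r}(s)+R_\theta\left(d\mathbf{r}_s(T_s(S^1))\right)\right).$$ The set $\mathcal{NS}_{\mathbf{r}}=\mathcal{NS}_{0,\mathbf{r}}$ (the complement of the union of all tangent lines) is called the no-silhouette of $\mathbf{r}$; ''$\mathbf{r}$ has its no-silhouette'' means that it is non-empty. In that case the aperture angle $\theta_{\mathbf{r}}$ ($0<\theta_{\mathbf{r}}\le\frac{\pi}{2}$)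 is the largest angle such that $\mathcal{NS}_{\theta,\mathbf{r}}\neq\emptyset$ for every $\theta$ with $0\le\theta<\theta_{\mathbf{r}}$. The bar denotes topological closure in $\mathbb{R}^2$. *)

(* Defs.v *)
From HB Require Import structures.
From mathcomp Require Import all_boot all_order all_algebra.
From mathcomp Require Import all_classical all_reals all_analysis.

Set Implicit Arguments.
Unset Strict Implicit.
Unset Printing Implicit Defensive.
Import Order.TTheory GRing.Theory Num.Theory.
Import numFieldNormedType.Exports.
Local Open Scope classical_set_scope.
Local Open Scope ring_scope.

(* The plane R^2 is the normed module R * R. *)

Definition S1 (R : realType) : Type :=
  {p : R * R | p.1 ^+ 2 + p.2 ^+ 2 == 1}.

Lemma S1_angle_subproof (R : realType) (t : R) :
  (cos t, sin t).1 ^+ 2 + (cos t, sin t).2 ^+ 2 == 1.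
Proof. by rewrite /= cos2Dsin2. Qed.

(* The universal covering R -> S^1.  It is a local diffeomorphism, so that the
   smoothness and the differential of a map on S^1 are those of its lift. *)
Definition S1_angle (R : realType) (t : R) : S1 R :=
  exist _ (cos t, sin t) (S1_angle_subproof t).

Definition angular_lift (R : realType) (r : S1 R -> R * R) : R -> R * R :=
  fun t => r (S1_angle t).

Definition smooth (R : realType) (r : S1 R -> R * R) : Prop :=
  forall (n : nat) (t : R), derivable (derive1n n (angular_lift r)) t 1.

Definition smooth_immersion (R : realType) (r : S1 R -> R * R) : Prop :=
  smooth r /\ forall t : R, derive1 (angular_lift r) t != 0.

(* The linear subspace dr_s(T_s S^1) of R^2.  All the angles t of s give the
   same velocity vector, since they differ by multiples of 2 pi. *)
Definition tangent_direction (R : realType) (r : S1 R -> R * R) (s : S1 R) :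
    set (R * R) :=
  [set v | exists t a : R, S1_angle t = s /\ v = a *: derive1 (angular_lift r) t].

Definition rotation (R : realType) (theta : R) (p : R * R) : R * R :=
  (p.1 * cos theta - p.2 * sin theta, p.1 * sin theta + p.2 * cos theta).

Definition NS (R : realType) (theta : R) (r : S1 R -> R * R) : set (R * R) :=
  [set: R * R] `\`
  \bigcup_(s in [set: S1 R])
    [set r s + rotation theta v | v in tangent_direction r s].

Definition no_silhouette (R : realType) (r : S1 R -> R * R) : set (R * R) :=
  NS 0 r.

Definition is_aperture_angle (R : realType) (r : S1 R -> R * R) (a : R) : Prop :=
  let admissible (b : R) := [/\ 0 < b, b <= pi / 2 &
    forall theta : R, 0 <= theta -> theta < b -> NS theta r !=set0] in
  admissible a /\ forall b : R, admissible b -> b <= a.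

Definition segment (R : realType) (p q : R * R) : set (R * R) :=
  [set (1 - t) *: p + t *: q | t in `[0, 1]].

(* The vertices of a simple closed polygonal chain in cyclic order: the edge i
   joins v i to v (ordS i), where ordS is the cyclic successor, and two distinct
   edges meet at most at a vertex that they share as consecutive edges. *)
Definition simple_closed_chain (R : realType) (n : nat) (v : 'I_n -> R * R) :
    Prop :=
  [/\ (3 <= n)%N, injective v &
    forall (i j : 'I_n) (x : R * R), i != j ->
      segment (v i) (v (ordS i)) x -> segment (v j) (v (ordS j)) x ->
      (j = ordS i /\ x = v j) \/ (i = ordS j /\ x = v i)].

(* A polygon is the closed bounded region enclosed by a simple closed polygonal
   chain, not necessarily convex.  A compact set whose frontier is a Jordan
   curve J is either J itself or J together with the bounded component of its
   complement; the non-empty interior selects the latter. *)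
Definition polygon (R : realType) (P : set (R * R)) : Prop :=
  exists (n : nat) (v : 'I_n -> R * R),
    [/\ simple_closed_chain v, compact P, interior P !=set0 &
      closure P `\` interior P =
        \bigcup_(i in [set: 'I_n]) segment (v i) (v (ordS i))].

(* Main.v *)
Require Import Defs.
From mathcomp Require Import all_boot all_order all_algebra.
From mathcomp Require Import all_classical all_reals all_analysis.
From mathcomp Require Import ring lra.
Import Order.TTheory GRing.Theory Num.Theory.
Import numFieldNormedType.Exports.
Local Open Scope classical_set_scope.
Local Open Scope ring_scope.

(** The turned tangent lines l_t = c(t) + R_theta(R c'(t)) are the zero lines of
    the functions X |-> side X t = (X - c(t)) x R_theta c'(t), which are affine
    in X, and NS is the set of the X for which side X never vanishes.  By
    continuity in t, side X then has a constant sign, and a point of the closure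
    of NS keeps a weak sign; moreover NS is open, because the circle is compact.

    The frontier of a polygon contains a segment with distinct ends p and q, so
    it suffices that the frontier of the closure of NS contains no such segment
    ([frontier_no_segment]).  Among three points of the segment two have the same
    weak sign; let p and q be these.  Their midpoint is outside NS, hence on some
    l_t.  As side is affine and both ends have the same sign, side p and side q
    vanish at t, and t is an extremum of both, so that their time derivatives
    vanish there as well ([zero_inside_edge]).  Subtracting, p - q is orthogonal
    to the normals of both R_theta c'(t) and R_theta c''(t): these two vectors
    are parallel.  As p is on l_t, the vector p - c(t) is parallel to them too,
    and in the derivative of side p only the term - c' x R_theta c' =
    - sin(theta) |c'|^2 remains, which is not 0 for 0 < theta < pi.  For
    theta = 0 this term vanishes, and the tangent lines at inflection points can
    contribute straight edges. *)

Set Implicit Arguments.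
Unset Strict Implicit.

(** * Plane vectors *)

Definition cross (R : realType) (u v : R * R) : R := u.1 * v.2 - u.2 * v.1.

Lemma pair_neq0 (R : realType) (u : R * R) : u != 0 -> u.1 != 0 \/ u.2 != 0.
Proof.
case: u => a b /= ab0; have [a0|] := eqVneq a 0; last by left.
by right; apply: contra ab0 => /eqP ->; rewrite a0.
Qed.

(** Parallelism is transitive through a nonzero vector: each coordinate of w
    times u x v is a combination of u x w and w x v. *)
Lemma cross_trans (R : realType) (u w v : R * R) :
  w != 0 -> cross u w = 0 -> cross w v = 0 -> cross u v = 0.
Proof.
move=> /pair_neq0 w0 uw wv.
have e1 : w.1 * cross u v = v.1 * cross u w + u.1 * cross w v.
  by rewrite /cross; ring.
have e2 : w.2 * cross u v = v.2 * cross u w + u.2 * cross w v.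
  by rewrite /cross; ring.
by case: w0 => /mulfI; apply; rewrite ?e1 ?e2 uw wv !mulr0 addr0.
Qed.

Lemma cross_anti (R : realType) (u v : R * R) : cross u v = - cross v u.
Proof. rewrite /cross; ring. Qed.

Lemma cross_rotation_self (R : realType) (theta : R) (u : R * R) :
  cross u (rotation theta u) = sin theta * (u.1 ^+ 2 + u.2 ^+ 2).
Proof. rewrite /cross /rotation /=; ring. Qed.

Lemma sqr_norm_neq0 (R : realType) (u : R * R) :
  u != 0 -> u.1 ^+ 2 + u.2 ^+ 2 != 0.
Proof.
by move=> /pair_neq0 u0; rewrite paddr_eq0 ?sqr_ge0// !sqrf_eq0 negb_and; apply/orP.
Qed.

Lemma rotation_neq0 (R : realType) (theta : R) (u : R * R) :
  u != 0 -> rotation theta u != 0.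
Proof.
move=> /sqr_norm_neq0 u0; apply: contra u0 => /eqP[h1 h2]; apply/eqP.
(* the squared length is invariant under rotation *)
rewrite -[LHS]mulr1 -(cos2Dsin2 theta).
transitivity ((u.1 * cos theta - u.2 * sin theta) ^+ 2 +
  (u.1 * sin theta + u.2 * cos theta) ^+ 2); first by ring.
by rewrite h1 h2; ring.
Qed.

Lemma parallel_scale (R : realType) (u w : R * R) :
  w != 0 -> cross u w = 0 -> exists a, u = a *: w.
Proof.
case: u w => [a b] [x y] /pair_neq0 /= w0; rewrite /cross /= => /eqP.
rewrite subr_eq0 => /eqP ab.
case: w0 => w0; [exists (a / x)|exists (b / y)]; congr (_, _) => /=;
  rewrite /GRing.scale /= ?divfK // mulrAC; apply: (canRL (mulfK w0)).
  by rewrite ab.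
by rewrite ab.
Qed.

Lemma rotationZ (R : realType) (theta a : R) (u : R * R) :
  rotation theta (a *: u) = a *: rotation theta u.
Proof. by congr (_, _); rewrite /= /GRing.scale /=; ring. Qed.

Lemma continuous_rotation (R : realType) (theta : R) :
  continuous (@rotation R theta).
Proof.
move=> u.
have h1 : (fun v : R * R => v.1 * cos theta - v.2 * sin theta) @ u -->
    u.1 * cos theta - u.2 * sin theta.
  by apply: cvgB; apply: cvgMr_tmp; [exact: cvg_fst|exact: cvg_snd].
have h2 : (fun v : R * R => v.1 * sin theta + v.2 * cos theta) @ u -->
    u.1 * sin theta + u.2 * cos theta.
  by apply: cvgD; apply: cvgMr_tmp; [exact: cvg_fst|exact: cvg_snd].
exact: cvg_pair h1 h2.
Qed.

Lemma cvg_cross (R : realType) (T : Type) (F : set_system T) (FF : Filter F)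
    (f g : T -> R * R) (u v : R * R) :
  f @ F --> u -> g @ F --> v -> (fun x => cross (f x) (g x)) @ F --> cross u v.
Proof.
move=> fu gv; rewrite /cross.
apply: cvgB; apply: cvgM.
- exact: (cvg_comp _ _ fu (@cvg_fst _ _ _ _ _)).
- exact: (cvg_comp _ _ gv (@cvg_snd _ _ _ _ _)).
- exact: (cvg_comp _ _ fu (@cvg_snd _ _ _ _ _)).
- exact: (cvg_comp _ _ gv (@cvg_fst _ _ _ _ _)).
Qed.

(** * The functions vanishing on the turned tangent lines *)

Definition side (R : realType) (theta : R) (c : R -> R * R) (X : R * R) (t : R) : R :=
  cross (X - c t) (rotation theta (derive1 c t)).

Lemma is_derive_fst (R : realType) (c : R -> R * R) (t : R) :
  derivable c t 1 -> is_derive t 1 (fst \o c) (derive1 c t).1.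
Proof.
move=> dc.
have h : (fun h : R => h^-1 *: (((fst \o c) \o shift t) (h *: 1) - (fst \o c) t))
  @ 0^' --> (derive1 c t).1.
  rewrite derive1E; exact: (cvg_comp _ _ dc (@cvg_fst _ _ _ _ _)).
apply: DeriveDef; first by apply/cvg_ex; exists (derive1 c t).1.
exact: cvg_lim h.
Qed.

Lemma is_derive_snd (R : realType) (c : R -> R * R) (t : R) :
  derivable c t 1 -> is_derive t 1 (snd \o c) (derive1 c t).2.
Proof.
move=> dc.
have h : (fun h : R => h^-1 *: (((snd \o c) \o shift t) (h *: 1) - (snd \o c) t))
  @ 0^' --> (derive1 c t).2.
  rewrite derive1E; exact: (cvg_comp _ _ dc (@cvg_snd _ _ _ _ _)).
apply: DeriveDef; first by apply/cvg_ex; exists (derive1 c t).2.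
exact: cvg_lim h.
Qed.

(** The second term is sin(theta) |c'|^2 ([cross_rotation_self]); it is what
    distinguishes theta <> 0 from the family of the tangent lines. *)
Lemma is_derive_side (R : realType) (theta : R) (c : R -> R * R) (X : R * R) (t : R) :
  derivable c t 1 -> derivable (derive1 c) t 1 ->
  is_derive t 1 (side theta c X)
    (cross (X - c t) (rotation theta (derive1 (derive1 c) t))
      - cross (derive1 c t) (rotation theta (derive1 c t))).
Proof.
move=> dc dc'.
have d1 := is_derive_fst dc; have d2 := is_derive_snd dc.
have d1' := is_derive_fst dc'; have d2' := is_derive_snd dc'.
have dp1 := is_deriveB (is_derive_cst X.1 t 1) d1.
have dp2 := is_deriveB (is_derive_cst X.2 t 1) d2.
have dw1 := is_deriveB (is_deriveZ (cos theta) d1') (is_deriveZ (sin theta) d2').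
have dw2 := is_deriveD (is_deriveZ (sin theta) d1') (is_deriveZ (cos theta) d2').
have dside := is_deriveB (is_deriveM dp1 dw2) (is_deriveM dp2 dw1).
rewrite (_ : side theta c X = (cst X.1 - (fst \o c)) *
    (sin theta \*: (fst \o derive1 c) + cos theta \*: (snd \o derive1 c)) -
  (cst X.2 - (snd \o c)) *
    (cos theta \*: (fst \o derive1 c) - sin theta \*: (snd \o derive1 c))).
  apply: is_derive_eq dside _.
  rewrite /cross /rotation /= !fctE /=.
  move: (c t) (derive1 c t) (derive1 (derive1 c) t) => C C' C''.
  by rewrite /GRing.scale /=; ring.
apply/funext => u.
by rewrite /side /cross /rotation /= !fctE /= /GRing.scale /=; ring.
Qed.

Lemma side_convex (R : realType) (theta : R) (c : R -> R * R) (p q : R * R) (u t : R) :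
  side theta c ((1 - u) *: p + u *: q) t =
  (1 - u) * side theta c p t + u * side theta c q t.
Proof. by rewrite /side /cross /= /GRing.scale /=; ring. Qed.

(** Joint continuity in the time and the point, as needed for the compactness
    argument of [NS_open]. *)
Lemma continuous_side (R : realType) (theta : R) (c : R -> R * R) :
  continuous c -> continuous (derive1 c) ->
  continuous (fun z : R * (R * R) => side theta c z.2 z.1).
Proof.
move=> cc cc' z.
have z1 : (fun x : R * (R * R) => x.1) @ z --> z.1 by exact: cvg_fst.
have cz : (fun x : R * (R * R) => c x.1) @ z --> c z.1.
  exact: (continuous_cvg _ (cc z.1) z1).
have cz' : (fun x : R * (R * R) => derive1 c x.1) @ z --> derive1 c z.1.
  exact: (continuous_cvg _ (cc' z.1) z1).
apply: cvg_cross; first by apply: cvgB cz; exact: cvg_snd.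
exact: (continuous_cvg _ (@continuous_rotation R theta _) cz').
Qed.

Lemma continuous_side_point (R : realType) (theta : R) (c : R -> R * R) t :
  continuous (fun X : R * R => side theta c X t).
Proof.
move=> X; apply: cvg_cross; last exact: cvg_cst.
by apply: cvgB; [exact: cvg_id|exact: cvg_cst].
Qed.

Lemma continuous_side_time (R : realType) (theta : R) (c : R -> R * R) (X : R * R) :
  continuous c -> continuous (derive1 c) -> continuous (side theta c X).
Proof.
move=> cc cc' t.
have tX : (fun u : R => (u, X)) @ t --> (t, X) by exact: cvg_pair cvg_id (cvg_cst X).
exact: (continuous_cvg _ (@continuous_side _ theta _ cc cc' (t, X)) tX).
Qed.

(** * Signs and extrema *)

Lemma derive0_at_zero_min (R : realType) (f : R -> R) (t : R) :
  (forall u, derivable f u 1) -> (forall u, 0 <= f u) -> f t = 0 ->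
  derive1 f t = 0.
Proof.
move=> df f0 ft.
have tin : t \in `](t - 1), (t + 1)[ by rewrite in_itv /=; apply/andP; split; lra.
have := @derive1_at_min R f (t - 1) (t + 1) t _ _ tin.
by rewrite derive1E => h; apply: derive_val; apply: h => [|//|u _]; [lra|rewrite ft].
Qed.

Lemma zero_between (R : realType) (a b v : R) :
  0 <= a -> 0 <= b -> 0 < v < 1 -> (1 - v) * a + v * b = 0 -> a = 0 /\ b = 0.
Proof.
move=> a0 b0 /andP[v0 v1] /eqP.
have v1' : 0 < 1 - v by lra.
rewrite paddr_eq0; [|exact: mulr_ge0 (ltW _) _|exact: mulr_ge0 (ltW _) _].
rewrite !mulf_eq0 (gt_eqF v0) (gt_eqF v1') /=.
by case/andP=> /eqP -> /eqP ->.
Qed.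

(** The core of the proof.  If side vanished at t inside the segment, it would
    vanish at both ends, where t would be an extremum because of the weak sign.
    These four equations, for side and its time derivative at p and at q, make
    c'(t) and c''(t) parallel and leave sin(theta) |c'(t)|^2 = 0. *)
Lemma zero_inside_edge (R : realType) (theta : R) (c : R -> R * R) (p q : R * R)
    (v t : R) (e : bool) :
  (forall u, derivable c u 1) -> (forall u, derivable (derive1 c) u 1) ->
  derive1 c t != 0 -> sin theta != 0 -> p != q -> 0 < v < 1 ->
  (forall u, 0 <= (-1) ^+ e * side theta c p u) ->
  (forall u, 0 <= (-1) ^+ e * side theta c q u) ->
  side theta c ((1 - v) *: p + v *: q) t != 0.
Proof.
move=> dc dc' c'0 s0 pq v01 p0 q0; apply/eqP => M0.
have [pt qt] : (-1) ^+ e * side theta c p t = 0 /\ (-1) ^+ e * side theta c q t = 0.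
  apply: (@zero_between _ _ _ v) => //.
  by rewrite mulrCA [v * _]mulrCA -mulrDr -side_convex M0 mulr0.
have sg0 : (-1) ^+ e != 0 :> R by rewrite signr_eq0.
have crit X : (forall u, 0 <= (-1) ^+ e * side theta c X u) ->
    (-1) ^+ e * side theta c X t = 0 ->
    cross (X - c t) (rotation theta (derive1 (derive1 c) t)) =
    cross (derive1 c t) (rotation theta (derive1 c t)).
  move=> X0 Xt.
  have dX u := is_derive_side theta X (dc u) (dc' u).
  have dsX (u : R) : is_derive u 1 (fun u : R => (-1) ^+ e * side theta c X u)
    ((-1) ^+ e * (cross (X - c u) (rotation theta (derive1 (derive1 c) u))
      - cross (derive1 c u) (rotation theta (derive1 c u)))).
    exact: is_deriveZ.
  have : derive1 (fun u : R => (-1) ^+ e * side theta c X u) t = 0.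
    by apply: derive0_at_zero_min => // u; exact: ex_derive.
  have dt := dsX t.
  rewrite derive1E derive_val => /eqP.
  by rewrite mulf_eq0 (negbTE sg0) subr_eq0 => /eqP.
have cp := crit _ p0 pt; have cq := crit _ q0 qt.
move/eqP: pt; rewrite mulf_eq0 (negbTE sg0) /= => /eqP pt.
move/eqP: qt; rewrite mulf_eq0 (negbTE sg0) /= => /eqP qt.
(* c(t) cancels in the difference of the equations at p and q *)
have diff w : cross (p - q) w = cross (p - c t) w - cross (q - c t) w.
  by rewrite /cross /=; ring.
have h1 : cross (rotation theta (derive1 c t)) (p - q) = 0.
  by rewrite cross_anti diff -/(side _ _ _ _) -/(side _ _ _ _) pt qt subrr oppr0.
have h2 : cross (p - q) (rotation theta (derive1 (derive1 c) t)) = 0.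
  by rewrite diff cp cq subrr.
have pq0 : p - q != 0 by rewrite subr_eq0.
have h3 := cross_trans pq0 h1 h2.
have := cross_trans (rotation_neq0 theta c'0) pt h3.
rewrite cp cross_rotation_self => /eqP.
by rewrite mulf_eq0 (negbTE s0) (negbTE (sqr_norm_neq0 c'0)).
Qed.

Lemma constant_sign (R : realType) (f : R -> R) :
  (forall t u, 0 <= f t * f u) -> exists e : bool, forall t, 0 <= (-1) ^+ e * f t.
Proof.
move=> f0; have [[t ft]|nf] := pselect (exists t, 0 < f t).
  by exists false => u; rewrite mul1r -(pmulr_rge0 _ ft).
exists true => u; rewrite mulN1r oppr_ge0 leNgt; apply/negP => fu.
by apply: nf; exists u.
Qed.

(** The constant sign is expressed by products of two values because this form
    passes to limits of f without choosing a sign for each f. *)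
Lemma nonvanishing_sign (R : realType) (f : R -> R) :
  continuous f -> (forall t, f t != 0) -> forall t u, 0 <= f t * f u.
Proof.
move=> cf f0 t u; wlog tu : t u / t <= u.
  by move=> H; have [/H//|/ltW/H] := leP t u; rewrite mulrC.
rewrite leNgt; apply/negP => ftu.
have [||z _ fz] := @IVT R f t u 0 tu; first exact: continuous_subspaceT.
  have /orP[] : ((f t <= 0) && (0 <= f u)) || ((f u <= 0) && (0 <= f t)).
  - have [a|a] := leP (f t) 0; have [b|b] := leP (f u) 0 => /=.
    + by move: ftu; rewrite ltNge mulr_le0.
    + by rewrite ltW.
    + by rewrite ltW.
    + by move: ftu; rewrite ltNge mulr_ge0 // ltW.
  - by case/andP=> a b; rewrite ge_min le_max a b orbT.
  - by case/andP=> a b; rewrite ge_min le_max a b orbT.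
by move: (f0 z); rewrite fz eqxx.
Qed.

(** * The set NS *)

Lemma NS_side_neq0 (R : realType) (r : S1 R -> R * R) (theta : R) (X : R * R) :
  (forall t, derive1 (angular_lift r) t != 0) ->
  NS theta r X <-> forall t, side theta (angular_lift r) X t != 0.
Proof.
move=> c'0; split=> [[_ nX] t|nX]; last first.
  split=> // -[s _ [v [t [a [<- ->]]]] XE].
  case/eqP: (nX t); rewrite /side -XE -/(angular_lift r t) rotationZ.
  by rewrite /cross /= /GRing.scale /=; ring.
apply/eqP => /(parallel_scale (rotation_neq0 theta (c'0 t)))[a Xa]; apply: nX.
exists (S1_angle t) => //; exists (a *: derive1 (angular_lift r) t).
  by exists t, a.
by rewrite rotationZ -Xa /angular_lift addrC subrK.
Qed.

Lemma S1_angle_eq (R : realType) (t u : R) :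
  cos t = cos u -> sin t = sin u -> S1_angle t = S1_angle u.
Proof. by move=> ct st; apply: val_inj; rewrite /= ct st. Qed.

(** The interval [-pi, pi] covers the circle; it replaces the compact circle in
    [NS_open]. *)
Lemma S1_angle_pi (R : realType) (t : R) :
  exists2 u, u \in `[(- pi), pi] & S1_angle u = S1_angle t.
Proof.
have ct : -1 <= cos t <= 1 by rewrite cos_geN1 cos_le1.
have a0 := acos_ge0 ct; have api := acos_lepi ct.
have ca : cos (acos (cos t)) = cos t by rewrite acosK // in_itv.
have sa : sin (acos (cos t)) = `|sin t|.
  by rewrite sin_acos // -sin2cos2 sqrtr_sqr.
have [st|st] := leP 0 (sin t).
  exists (acos (cos t)); first by rewrite in_itv /=; apply/andP; split; lra.
  by apply: S1_angle_eq => //; rewrite sa ger0_norm.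
exists (- acos (cos t)); first by rewrite in_itv /=; apply/andP; split; lra.
by apply: S1_angle_eq; rewrite ?cosN // sinN sa ltr0_norm ?opprK.
Qed.

(** Two angles of the same point stay so when shifted by the same h, hence give
    equal difference quotients of the lift and equal velocities. *)
Lemma side_S1_angle (R : realType) (r : S1 R -> R * R) (theta t u : R) (X : R * R) :
  S1_angle t = S1_angle u ->
  side theta (angular_lift r) X t = side theta (angular_lift r) X u.
Proof.
move=> tu; have lift_shift h : angular_lift r (h + t) = angular_lift r (h + u).
  rewrite /angular_lift; congr r.
  by case: tu => ct st; apply: S1_angle_eq; rewrite ?cosD ?sinD ct st.
have lift_tu : angular_lift r t = angular_lift r u by rewrite /angular_lift tu.
have quotient_tu :
    (fun h => h^-1 *: (angular_lift r (h + t) - angular_lift r t)) =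
    (fun h => h^-1 *: (angular_lift r (h + u) - angular_lift r u)).
  by apply/funext => h; rewrite lift_shift lift_tu.
have velocity_tu : derive1 (angular_lift r) t = derive1 (angular_lift r) u.
  by rewrite /derive1 quotient_tu.
by rewrite /side lift_tu velocity_tu.
Qed.

(** Openness needs the compactness of the circle: near a point X of NS, side is
    nonzero on a neighbourhood of each (t, X), and finitely many of these
    neighbourhoods cover [-pi, pi] x {X}. *)
Lemma NS_open (R : realType) (r : S1 R -> R * R) (theta : R) :
  continuous (angular_lift r) -> continuous (derive1 (angular_lift r)) ->
  (forall t, derive1 (angular_lift r) t != 0) -> open (NS theta r).
Proof.
move=> cc cc' c'0; rewrite openE => X /(NS_side_neq0 _ _ c'0) nX.
have /compact_near_coveringP K := @segment_compact R (- pi) pi.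
have : \forall Y \near X,
    `[(- pi), pi] `<=` (fun t => side theta (angular_lift r) Y t != 0).
  apply: (K _ (nbhs X) (fun Y t => side theta (angular_lift r) Y t != 0)) => t _.
  have nb : nbhs (side theta (angular_lift r) X t) [set y | y != 0].
    by apply: open_nbhs_nbhs; split; [exact: open_neq|exact: nX].
  exact: (@continuous_side _ theta _ cc cc' (t, X) _ nb).
apply: filterS => Y nY; apply/(NS_side_neq0 _ _ c'0) => t.
have [u upi ut] := S1_angle_pi t.
by rewrite -(side_S1_angle r theta Y ut); exact: nY.
Qed.

Lemma NS_interior_closure (R : realType) (r : S1 R -> R * R) (theta : R) :
  continuous (angular_lift r) -> continuous (derive1 (angular_lift r)) ->
  (forall t, derive1 (angular_lift r) t != 0) ->
  NS theta r `<=` interior (closure (NS theta r)).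
Proof.
move=> cc cc' c'0; rewrite -open_subsetE; last exact: NS_open.
exact: subset_closure.
Qed.

(** A strict change of sign of side X would persist for nearby points of NS. *)
Lemma closure_NS_sign (R : realType) (r : S1 R -> R * R) (theta : R) (X : R * R) :
  continuous (angular_lift r) -> continuous (derive1 (angular_lift r)) ->
  (forall t, derive1 (angular_lift r) t != 0) -> closure (NS theta r) X ->
  exists e : bool, forall t, 0 <= (-1) ^+ e * side theta (angular_lift r) X t.
Proof.
move=> cc cc' c'0 clX; apply: constant_sign => t u.
rewrite leNgt; apply/negP => tu0.
have cf : (fun Y => side theta (angular_lift r) Y t * side theta (angular_lift r) Y u) @ X
   --> side theta (angular_lift r) X t * side theta (angular_lift r) X u.
  by apply: cvgM; exact: continuous_side_point.
have := cf _ (open_nbhs_nbhs (conj (@open_lt R 0) tu0)).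
move=> /clX[Y [/(NS_side_neq0 _ _ c'0) nY /=]].
have cside : continuous (side theta (angular_lift r) Y).
  exact: (continuous_side_time cc cc').
by rewrite ltNge nonvanishing_sign.
Qed.

Lemma smooth_continuous (R : realType) (r : S1 R -> R * R) (n : nat) :
  smooth r -> continuous (derive1n n (angular_lift r)).
Proof.
by move=> sr t; apply: differentiable_continuous; apply/derivable1_diffP.
Qed.

(** * Frontier segments *)

(** Points of the closure of NS could a priori have different signs, so three
    points of the segment are tested: two of them agree, and [zero_inside_edge]
    puts their midpoint into NS, which is open and hence disjoint from the
    frontier of its closure. *)
Lemma frontier_no_segment (R : realType) (r : S1 R -> R * R) (theta : R) (p q : R * R) :
  smooth_immersion r -> sin theta != 0 -> p != q ->
  ~ (segment p q `<=` closure (NS theta r) `\` interior (closure (NS theta r))).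
Proof.
move=> [sr c'0] s0 pq pqNS.
have dc := sr 0; have dc' := sr 1.
have cc := @smooth_continuous _ _ 0 sr; have cc' := @smooth_continuous _ _ 1 sr.
pose pt (u : R) := (1 - u) *: p + u *: q.
pose signed (e : bool) u :=
  forall t, 0 <= (-1) ^+ e * side theta (angular_lift r) (pt u) t.
have sgn u : 0 <= u <= 1 -> exists e, signed e u.
  move=> u01; apply: closure_NS_sign => //.
  by have [] := pqNS (pt u) (ex_intro2 _ _ u u01 erefl).
have same_sign e (a d : R) : 0 <= a -> a < d -> d <= 1 ->
    signed e a -> signed e d -> False.
  move=> a0 ad d1 sa sd; pose b := (a + d) / 2.
  have b01 : 0 <= b <= 1 by rewrite /b; apply/andP; split; lra.
  have [_ nib] := pqNS (pt b) (ex_intro2 _ _ b b01 erefl).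
  apply: nib; apply: NS_interior_closure => //.
  apply/(NS_side_neq0 _ _ c'0) => t.
  have -> : pt b = (1 - 1 / 2) *: pt a + (1 / 2) *: pt d.
    by congr (_, _); rewrite /b /= /GRing.scale /=; field.
  have half01 : 0 < (1 / 2 : R) < 1 by apply/andP; split; lra.
  have pad : pt a != pt d.
    apply: contra pq => /eqP pad.
    have : (d - a) *: (p - q) = pt a - pt d.
      by congr (_, _); rewrite /pt /= /GRing.scale /=; ring.
    move/eqP; rewrite pad subrr scaler_eq0 subr_eq0 (gt_eqF ad).
    by rewrite subr_eq0.
  exact: zero_inside_edge dc dc' (c'0 t) s0 pad half01 sa sd.
have [e0 h0] : exists e, signed e 0 by apply: sgn; apply/andP; split; lra.
have [e1 h1] : exists e, signed e (1 / 2) by apply: sgn; apply/andP; split; lra.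
have [e2 h2] : exists e, signed e 1 by apply: sgn; apply/andP; split; lra.
have [e01|e01] := eqVneq e0 e1.
  by apply: (@same_sign e1 0 (1 / 2)); [lra|lra|lra|rewrite -e01|].
have [e12|e12] := eqVneq e1 e2.
  by apply: (@same_sign e2 (1 / 2) 1); [lra|lra|lra|rewrite -e12|].
have e02 : e0 = e2 by move: e01 e12; clear; case: e0; case: e1; case: e2.
by apply: (@same_sign e2 0 1); [lra|lra|lra|rewrite -e02|].
Qed.

Unset Implicit Arguments.

Theorem theorem1 (R : realType) (r : S1 R -> R * R) (theta_r : R) :
  smooth_immersion r ->
  no_silhouette r !=set0 ->
  is_aperture_angle r theta_r ->
  forall theta : R, 0 < theta -> theta < theta_r ->
    ~ polygon (closure (NS theta r)).
Proof.
move=> ri _ [[_ theta_r_pi _] _] theta theta0 theta_lt.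
move=> [n [v [[n3 v_inj _] _ _ frontierE]]].
have s0 : sin theta != 0.
  rewrite gt_eqF // sin_gt0_pi // theta0 /=.
  have := pi_gt0 R; lra.
have i : 'I_n by exists 0%N; exact: leq_trans n3.
have vi : v i != v (ordS i).
  rewrite (inj_eq v_inj); apply/eqP => /(congr1 val) /=.
  have [lt_in|] := ltnP i.+1 n; first by rewrite modn_small // => /n_Sn.
  move=> le_ni; have -> : i.+1 = n by apply/eqP; rewrite eqn_leq le_ni ltn_ord.
  rewrite modnn => i0; move: le_ni; rewrite i0.
  by move/(leq_trans n3).
apply: (frontier_no_segment ri s0 vi) => x vx.
have : (\bigcup_(j in [set: 'I_n]) segment (v j) (v (ordS j))) x by exists i.
by rewrite -frontierE -(closure_id _).1 //; exact: closed_closure.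
Qed.
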